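(* Let $A$ be an algebra which has permuting uniformities. Then the lattice $\operatorname{Unif} A$ of compatible uniformities on $A$ is modular.
   Context: A uniformity on a set $S$ is a filter $\mathcal U$ of reflexive binary relations on $S$ such that $U\in\mathcal U$ implies $U^{-1}\in\mathcal U$, and for every $U\in\mathcal U$ there is $V\in\mathcal U$ with $V\circ V\subseteq U$. A uniformity on the underlying set of an algebra $A$ is compatible if all basic operations of $A$ are uniformly continuous; $\operatorname{Unif} A$ is the complete lattice of compatible uniformities, ordered by reverse inclusion ($\mathcal U_1\le\mathcal U_2$ iff $\mathcal U_2\subseteq\mathcal U_1$). For sets of relations, $\mathcal U\circ\mathcal V=\{U\circ V\mid U\in\mathcal U, V\in\mathcal V\}$ where $U\circ V$ is the relational product; $\operatorname{Fg}$ denotes the generated filter of binary relations. Uniformities $\mathcal U,\mathcal V$ permute if $\operatorname{Fg}(\mathcal U\circ\mathcal V)=\operatorname{Fg}(\mathcal V\circ\mathcal U)$. An algebra $A$ has permuting uniformities if any two of its compatible uniformities permute. *)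

(* Defs.v *)
From HB Require Import structures.
From mathcomp Require Import all_boot all_order.
From mathcomp Require Import all_classical.

Set Implicit Arguments.
Unset Strict Implicit.
Unset Printing Implicit Defensive.

Import Order.TTheory.

Definition modular_lattice d (L : latticeType d) : Prop :=
  forall x y z : L,
    (x <= z -> x `|` (y `&` z) = (x `|` y) `&` z)%O.

Local Open Scope classical_set_scope.
Local Open Scope relation_scope.

Record signature : Type := Signature {
  symbol : Type;
  arity : symbol -> nat
}.

Record algebra (sigma : signature) : Type := Algebra {
  carrier :> Type;
  op : forall s : symbol sigma, ('I_(arity s) -> carrier) -> carrier
}.

(* The axioms are those of [uniformType]; they are restated as a predicate
   because many uniformities on one carrier are considered at once, and because
   the carrier has no choice structure.  [Filter] does not require properness,
   which here follows from reflexivity unless [S] is empty. *)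
Record uniformity (S : Type) (U : set_system (S * S)) : Prop := Uniformity {
  uniformity_filter : Filter U;
  uniformity_diagonal : forall E, U E -> diagonal `<=` E;
  uniformity_inv : forall E, U E -> U E^-1;
  uniformity_split : forall E, U E -> exists2 B, U B & B \; B `<=` E
}.

(* Product uniformity on S^n (cf. [mx_ent] for matrices). *)
Definition power_uniformity (S : Type) (n : nat) (U : set_system (S * S)) :
    set_system (('I_n -> S) * ('I_n -> S)) :=
  filter_from [set P : 'I_n -> set (S * S) | forall i, U (P i)]
    (fun P => [set xy | forall i, P i (xy.1 i, xy.2 i)]).

(* [unif_continuous] with explicit uniformities; the arrow is reverse inclusion
   of filters. *)
Definition uniformly_continuous (S T : Type) (U : set_system (S * S))
    (V : set_system (T * T)) (f : S -> T) : Prop :=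
  (fun xy : S * S => (f xy.1, f xy.2)) @ U `=>` V.

Definition compatible (sigma : signature) (A : algebra sigma)
    (U : set_system (A * A)) : Prop :=
  forall s : symbol sigma,
    uniformly_continuous (power_uniformity U) U (@op sigma A s).

Record Unif (sigma : signature) (A : algebra sigma) : Type := MkUnif {
  entourages :> set_system (A * A);
  entourages_uniformity : uniformity entourages;
  entourages_compatible : compatible entourages
}.

Definition Fg (T : Type) (G : set_system T) : set_system T := smallest Filter G.

Definition comp_system (S : Type) (U V : set_system (S * S)) :
    set_system (S * S) :=
  [set E | exists P Q : set (S * S), [/\ U P, V Q & E = P \; Q]].

Definition permute (S : Type) (U V : set_system (S * S)) : Prop :=
  Fg (comp_system U V) = Fg (comp_system V U).

Definition permuting_uniformities (sigma : signature) (A : algebra sigma) :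
    Prop :=
  forall U V : Unif A, permute U V.

Lemma power_uniformity_filter (S : Type) (n : nat) (U : set_system (S * S)) :
  Filter U -> Filter (@power_uniformity S n U).
Proof.
move=> FU; apply: filter_from_filter.
  by exists (fun=> setT) => i; exact: filterT.
move=> P Q UP UQ; exists (fun i => P i `&` Q i).
  by move=> i; exact: filterI.
by move=> xy PQ; split=> i; have [] := PQ i.
Qed.

Lemma power_uniformityS (S : Type) (n : nat) (U V : set_system (S * S)) :
  U `<=` V -> @power_uniformity S n U `<=` @power_uniformity S n V.
Proof. by move=> UV E [P UP PE]; exists P => // i; exact/UV/UP. Qed.

Section UnifLattice.
Context (sigma : signature) (A : algebra sigma).
Implicit Types (U V W : Unif A) (D : set (Unif A)).

Lemma Unif_eq U V : U = V :> set_system (A * A) -> U = V.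
Proof.
case: U V => U uU cU [V uV cV] /= UV; rewrite -{}UV in uV cV *.
by congr MkUnif; exact: Prop_irrelevance.
Qed.

(* Greatest lower bound of an arbitrary set [D] of compatible uniformities. *)
Definition inf_system D : set_system (A * A) :=
  Fg (\bigcup_(U in D) (U : set_system (A * A))).

Lemma inf_system_filter D : Filter (inf_system D).
Proof. exact: smallest_filter_filter. Qed.

Lemma sub_inf_system D U : D U -> U `<=` inf_system D.
Proof.
by move=> DU; apply: (subset_trans _ (@sub_gen_smallest _ _ _)) => E UE; exists U.
Qed.

Lemma inf_system_sub D (F : set_system (A * A)) : Filter F ->
  (forall U, D U -> U `<=` F) -> inf_system D `<=` F.
Proof.
by move=> FF DF; apply: smallest_sub => // E [U DU UE]; exact: (DF U).
Qed.

Lemma inf_system_uniformity D : uniformity (inf_system D).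
Proof.
have FI := inf_system_filter D.
split=> //.
- apply: (@inf_system_sub D [set E | diagonal `<=` E]).
  by move=> U _ E UE; exact: (uniformity_diagonal (entourages_uniformity U)).
- apply: (@inf_system_sub D [set E | inf_system D E^-1]).
    split.
    + exact: (@filterT _ _ FI).
    + by move=> P Q IP IQ; exact: (@filterI _ _ FI _ _ IP IQ).
    + by move=> P Q PQ; apply: (@filterS _ _ FI) => x; exact: PQ.
  move=> U DU E UE; apply: (sub_inf_system DU).
  exact: (uniformity_inv (entourages_uniformity U)).
- apply: (@inf_system_sub D
      [set E | exists2 B, inf_system D B & B \; B `<=` E]).
    split.
    + by exists setT => //; exact: (@filterT _ _ FI).
    + move=> P Q [B IB BP] [C IC CQ].
      exists (B `&` C); first exact: (@filterI _ _ FI).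
      move=> x [z [Bz Cz] [Bz' Cz']].
      by split; [apply: BP; exists z|apply: CQ; exists z].
    + by move=> P Q PQ [B IB BP]; exists B => //; exact: subset_trans PQ.
  move=> U DU E /(uniformity_split (entourages_uniformity U))[B UB BE].
  by exists B => //; exact: sub_inf_system UB.
Qed.

Lemma inf_system_compatible D : compatible (inf_system D).
Proof.
move=> s; apply: inf_system_sub => [|U DU E UE].
  apply: fmap_filter; exact: power_uniformity_filter.
apply: (power_uniformityS (sub_inf_system DU)).
exact: (@entourages_compatible _ A U s).
Qed.

Definition Unif_inf D : Unif A :=
  MkUnif (inf_system_uniformity D) (@inf_system_compatible D).

Definition Unif_le U V : bool := `[< V `<=` U >].

Lemma Unif_inf_lb D U : D U -> Unif_le (Unif_inf D) U.
Proof. by move=> DU; apply/asboolP; exact: sub_inf_system. Qed.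

Lemma Unif_inf_glb D V : (forall U, D U -> Unif_le V U) ->
  Unif_le V (Unif_inf D).
Proof.
move=> VD; apply/asboolP; apply: inf_system_sub => [|U /VD/asboolP//].
exact: (uniformity_filter (entourages_uniformity V)).
Qed.

Definition Unif_sup D : Unif A :=
  Unif_inf [set V | forall U, D U -> Unif_le U V].

Lemma Unif_sup_ub D U : D U -> Unif_le U (Unif_sup D).
Proof. by move=> DU; apply: Unif_inf_glb => V; exact. Qed.

Lemma Unif_sup_lub D V : (forall U, D U -> Unif_le U V) ->
  Unif_le (Unif_sup D) V.
Proof. by move=> DV; exact: Unif_inf_lb. Qed.

Definition Unif_meet U V : Unif A := Unif_inf [set U; V].

Definition Unif_join U V : Unif A := Unif_sup [set U; V].

Lemma Unif_le_refl : reflexive Unif_le.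
Proof. by move=> U; exact/asboolP. Qed.

Lemma Unif_le_anti : antisymmetric Unif_le.
Proof.
by move=> U V /andP[/asboolP VU /asboolP UV]; apply/Unif_eq/seteqP.
Qed.

Lemma Unif_le_trans : transitive Unif_le.
Proof.
move=> V U W /asboolP VU /asboolP WV; apply/asboolP.
exact: subset_trans VU.
Qed.

Lemma Unif_lexI W U V :
  Unif_le W (Unif_meet U V) = Unif_le W U && Unif_le W V.
Proof.
apply/idP/andP=> [WI|[WU WV]]; last by apply: Unif_inf_glb => ? [->|->].
by split; apply: (Unif_le_trans WI); apply: Unif_inf_lb; [left|right].
Qed.

Lemma Unif_leUx U V W :
  Unif_le (Unif_join U V) W = Unif_le U W && Unif_le V W.
Proof.
apply/idP/andP=> [IW|[UW VW]]; last by apply: Unif_sup_lub => ? [->|->].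
by split; apply: (Unif_le_trans _ IW); apply: Unif_sup_ub; [left|right].
Qed.

End UnifLattice.

Fact Unif_display : Order.disp_t. Proof. exact: (Order.Disp tt tt). Qed.

HB.instance Definition _ sigma (A : algebra sigma) := gen_eqMixin (Unif A).
HB.instance Definition _ sigma (A : algebra sigma) := gen_choiceMixin (Unif A).
HB.instance Definition _ sigma (A : algebra sigma) :=
  Order.Le_isPOrder.Build Unif_display (Unif A)
    (@Unif_le_refl sigma A) (@Unif_le_anti sigma A) (@Unif_le_trans sigma A).
HB.instance Definition _ sigma (A : algebra sigma) :=
  Order.POrder_MeetJoin_isLattice.Build Unif_display (Unif A)
    (@Unif_lexI sigma A) (@Unif_leUx sigma A).

(* Main.v *)
Require Import Defs.
From mathcomp Require Import all_boot all_order.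
From mathcomp Require Import all_classical.

Set Implicit Arguments.
Unset Strict Implicit.
Unset Printing Implicit Defensive.

Import Order.TTheory.

Local Open Scope classical_set_scope.
Local Open Scope relation_scope.

(** When [U] and [V] permute, the relational products [P \; Q] with [P] in [U]
    and [Q] in [V] form a base of [U `|` V].  As for congruences, the hard half
    of the modular law, [(x `|` y) `&` z <= x `|` (y `&` z)] for [x <= z], is
    then a diagram chase: if [a Q c P b] and [a T b], with [P] in [x], [Q] in
    [y] and [T] in [z], then shrinking [P] below [T^-1], which is allowed since
    the filter of [z] is included in that of [x], yields [a (T \; T) c].

    Pitfall: [P \; Q] relates [a] to [b] when [Q (a, c)] and [P (c, b)] for
    some [c], that is, [Q] is applied first. *)

Section UnifTheory.
Context (sigma : signature) (A : algebra sigma).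
Implicit Types (U V W x y z : Unif A) (E P Q : set (A * A)).

Lemma UnifS U P Q : P `<=` Q -> entourages U P -> entourages U Q.
Proof. exact: (@filterS _ _ (uniformity_filter (entourages_uniformity U))). Qed.

Lemma UnifI U P Q : entourages U P -> entourages U Q -> entourages U (P `&` Q).
Proof. exact: (@filterI _ _ (uniformity_filter (entourages_uniformity U))). Qed.

Lemma UnifT U : entourages U setT.
Proof. exact: (@filterT _ _ (uniformity_filter (entourages_uniformity U))). Qed.

Lemma UnifV U P : entourages U P -> entourages U P^-1.
Proof. exact: (uniformity_inv (entourages_uniformity U)). Qed.

Lemma Unif_diag U P a : entourages U P -> P (a, a).
Proof. by move=> /(uniformity_diagonal (entourages_uniformity U)); exact. Qed.

Lemma Unif_split U P : entourages U P ->
  exists2 Q, entourages U Q & Q \; Q `<=` P.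
Proof. exact: (uniformity_split (entourages_uniformity U)). Qed.

Lemma Unif_leP U V : reflect (V `<=` U) (U <= V)%O.
Proof. exact: asboolP. Qed.

Lemma Unif_leS U V P : (U <= V)%O -> entourages V P -> entourages U P.
Proof. by move=> /Unif_leP; exact. Qed.

Lemma Fg_comp U V P Q :
  entourages U P -> entourages V Q -> Fg (comp_system U V) (P \; Q).
Proof. by move=> UP VQ; apply: sub_gen_smallest; exists P, Q. Qed.

(** Products are already a filter base: [(P]&[P') \; (Q]&[Q')] lies inside both [P \; Q] and
    [P' \; Q']. *)
Lemma Fg_comp_systemP U V E :
  Fg (comp_system U V) E <-> exists P Q,
    [/\ entourages U P, entourages V Q & P \; Q `<=` E].
Proof.
split=> [|[P [Q [UP VQ PQE]]]]; last first.
  have FF : Filter (Fg (comp_system U V)) by exact: smallest_filter_filter.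
  by apply: filterS PQE _; exact: Fg_comp.
move: E; apply: smallest_sub => [|_ [P [Q [UP VQ ->]]]]; last first.
  by exists P, Q; split=> // ?.
split.
- by exists setT, setT; split=> //; exact: UnifT.
- move=> E E' [P [Q [UP VQ PQE]]] [P' [Q' [UP' VQ' PQE']]].
  exists (P `&` P'), (Q `&` Q'); split; [exact: UnifI|exact: UnifI|].
  move=> ab [c [Qc Q'c] [Pc P'c]].
  by split; [apply: PQE; exists c|apply: PQE'; exists c].
- move=> E E' EE' [P [Q [UP VQ PQE]]]; exists P, Q; split=> //.
  exact: subset_trans EE'.
Qed.

(** Inversion reverses the order of the factors, and halving meets a product in the wrong order;
    permutability repairs both. *)
Lemma Fg_comp_uniformity U V :
  permute U V -> uniformity (Fg (comp_system U V)).
Proof.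
move=> UV; split.
- exact: smallest_filter_filter.
- move=> E /Fg_comp_systemP[P [Q [UP VQ PQE]]] [a b] ab.
  have /= <- : a = b := ab.
  by apply: PQE; exists a; [exact: (Unif_diag a VQ)|exact: (Unif_diag a UP)].
- move=> E /Fg_comp_systemP[P [Q [UP VQ PQE]]].
  rewrite UV; apply/Fg_comp_systemP; exists Q^-1, P^-1.
  split; [exact: UnifV|exact: UnifV|].
  by move=> [a b] [c Pc Qc]; apply: PQE; exists c.
- move=> E /Fg_comp_systemP[P [Q [UP VQ PQE]]].
  have [P1 UP1 P1P] := Unif_split UP; have [Q1 VQ1 Q1Q] := Unif_split VQ.
  have : Fg (comp_system V U) (P1 \; Q1) by rewrite -UV; exact: Fg_comp.
  move=> /Fg_comp_systemP[Q2 [P2 [VQ2 UP2 QP2]]].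
  (* A two-step path reads [a Q1 c P2 b Q2 d P1 e]. Its middle [c P2 b Q2 d] is replaced by
     [c Q1 m P1 d], and equal neighbours then merge into [a Q m P e]. *)
  exists ((P1 `&` P2) \; (Q1 `&` Q2)).
    by apply: Fg_comp; exact: UnifI.
  move=> [a e] [b [c [Qac _] [_ Pcb]] [d [_ Qbd] [Pde _]]].
  have [m Qcm Pmd] : (P1 \; Q1) (c, d) by apply: QP2; exists b.
  by apply: PQE; exists m; [apply: Q1Q; exists c|apply: P1P; exists d].
Qed.

Lemma Fg_comp_compatible U V : compatible (Fg (comp_system U V)).
Proof.
move=> s E /Fg_comp_systemP[P [Q [UP VQ PQE]]].
have [P' UP' P'P] := entourages_compatible s UP.
have [Q' VQ' Q'Q] := entourages_compatible s VQ.
exists (fun i => P' i \; Q' i).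
  by move=> i; exact: Fg_comp.
move=> [a b] ab; apply: PQE.
(* Midpoints are chosen coordinatewise; [op] of them is the midpoint between [op a] and [op b]. *)
have /choice[c cP] : forall i, exists c, Q' i (a i, c) /\ P' i (c, b i).
  by move=> i; have [c ? ?] := ab i; exists c.
exists (op c); first by apply: (Q'Q (a, c)) => i; have [] := cP i.
by apply: (P'P (c, b)) => i; have [] := cP i.
Qed.

(** The meet is the filter generated by the union of [U] and [V], so it suffices that the sets above
    some [P]&[Q] form a filter containing both. *)
Lemma Unif_meetP U V E :
  entourages (U `&` V)%O E <-> exists P Q,
    [/\ entourages U P, entourages V Q & P `&` Q `<=` E].
Proof.
split=> [|[P [Q [UP VQ PQE]]]]; last first.
  apply: (UnifS PQE); apply: UnifI.
    exact: Unif_leS (leIl U V) UP.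
  exact: Unif_leS (leIr V U) VQ.
move: E; apply: inf_system_sub => [|W].
  split.
  - by exists setT, setT; split=> //; exact: UnifT.
  - move=> E E' [P [Q [UP VQ PQE]]] [P' [Q' [UP' VQ' PQE']]].
    exists (P `&` P'), (Q `&` Q'); split; [exact: UnifI|exact: UnifI|].
    by move=> ab [[? ?] [? ?]]; split; [exact: PQE|exact: PQE'].
  - move=> E E' EE' [P [Q [UP VQ PQE]]]; exists P, Q; split=> //.
    exact: subset_trans EE'.
by move=> [->|->] E WE; [exists E, setT|exists setT, E];
  split=> //; try exact: UnifT; move=> ? [].
Qed.

(** By reflexivity a product contains each of its factors, so the uniformity [W] of products is an
    upper bound of [U] and [V], hence above their join. *)
Lemma Unif_join_comp U V P Q :
  permute U V -> entourages U P -> entourages V Q ->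
  entourages (U `|` V)%O (P \; Q).
Proof.
move=> UV UP VQ.
pose W := MkUnif (Fg_comp_uniformity UV) (@Fg_comp_compatible U V).
suff UVW : (U `|` V <= W)%O by apply: (Unif_leS UVW); exact: Fg_comp.
rewrite leUx; apply/andP; split; apply/Unif_leP => E.
  move=> /Fg_comp_systemP[P' [Q' [UP' VQ' PQE]]].
  apply: UnifS UP' => -[a b] Pab; apply: PQE.
  by exists a => //; exact: (Unif_diag a VQ').
move=> /Fg_comp_systemP[P' [Q' [UP' VQ' PQE]]].
apply: UnifS VQ' => -[a b] Qab; apply: PQE.
by exists b => //; exact: (Unif_diag b UP').
Qed.

Lemma Unif_join_split U V E :
  entourages (U `|` V)%O E -> exists P Q,
    [/\ entourages U P, entourages V Q & P \; Q `<=` E].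
Proof.
move=> /Unif_split[B UVB BE]; exists B, B; split=> //.
  exact: Unif_leS (leUl U V) UVB.
exact: Unif_leS (leUr V U) UVB.
Qed.

End UnifTheory.

Theorem theorem6p2 (sigma : signature) (A : algebra sigma) :
  permuting_uniformities A -> modular_lattice (Unif A).
Proof.
move=> perm x y z xz; apply/le_anti/andP; split.
  by rewrite leUx !lexI leUl xz leIr lexU2 ?leIl ?orbT.
(* The order is reverse inclusion, so entourages of the larger side are pulled into the smaller
   one. *)
apply/Unif_leP => E /Unif_join_split[P [R [xP yzR PRE]]].
have /Unif_meetP[Q [S [yQ zS QSR]]] := yzR.
have [T zT TS] := Unif_split zS.
have xT : entourages x T^-1 by apply/UnifV/(Unif_leS xz).
apply/Unif_meetP; exists ((P `&` T^-1) \; Q), T; split=> //.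
  by apply: Unif_join_comp => //; exact: UnifI.
(* What remains is [R (a, c)]: [Q (a, c)] is given, and [S (a, c)] comes from [T \; T] through
   [b]. *)
move=> [a b] [[c Qac [Pcb Tbc]] Tab]; apply: PRE; exists c => //.
by apply: QSR; split=> //; apply: TS; exists b.
Qed.
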